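(* Let $q$ be an odd prime, let $H=\langle zc\rangle$ or $H=\langle zd\rangle$ in $\mathrm{SL}_2(q)$, and let $i,i',j,j'$ be any integers with $1\le 2i,\,2i'+1\le (q-3)/2$ and $1\le 2j,\,2j'+1\le (q-1)/2$. Then $$\dim\psi^H=1,\quad \dim\chi_{2i}^H=2,\quad \dim(2\chi_{2i'+1})^H=\dim\theta_{2j}^H=\dim(2\theta_{2j'+1})^H=0;$$ if $q\equiv 1\pmod 4$, then $$\dim\xi_1^H=\dim\xi_2^H=1,\quad \dim(2\eta_1)^H=\dim(2\eta_2)^H=0;$$ and if $q\equiv 3\pmod 4$, then $$\dim(2\operatorname{Re}\xi_1)^H=\dim(2\operatorname{Re}\eta_1)^H=0.$$
   Context: $\mathrm{SL}_2(q)$ is the group of $2\times 2$ matrices of determinant $1$ over $\mathbb{F}_q$. Let $\nu$ be a generator of $\mathbb{F}_q^\times$ and put $\mathbf{1}=\begin{pmatrix}1&0\\0&1\end{pmatrix}$, $z=\begin{pmatrix}-1&0\\0&-1\end{pmatrix}$, $c=\begin{pmatrix}1&0\\1&1\end{pmatrix}$, $d=\begin{pmatrix}1&0\\ \nu&1\end{pmatrix}$, $a=\begin{pmatrix}\nu&0\\0&\nu^{-1}\end{pmatrix}$, and let $b$ be an element of order $q+1$. The conjugacy classes of $\mathrm{SL}_2(q)$ are represented by $\mathbf{1},z,c,d,zc,zd,a^l,b^m$ with $1\le l\le (q-3)/2$, $1\le m\le (q-1)/2$. Let $\epsilon=(-1)^{(q-1)/2}$, $\zeta_r=\exp(2\pi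 \sqrt{-1}/r)$ and $\nu_r^s=\zeta_r^s+\zeta_r^{-s}$. The complex irreducible characters of $\mathrm{SL}_2(q)$ are the following, with $1\le i\le (q-3)/2$ and $1\le j\le (q-1)/2$: $$\begin{array}{l|cccccc} & \mathbf{1} & z & c & d & a^l & b^m\\ \hline \mathbf{1} & 1&1&1&1&1&1\\ \psi & q&q&0&0&1&-1\\ \chi_i & q+1&(-1)^i(q+1)&1&1&\nu_{q-1}^{il}&0\\ \theta_j & q-1&(-1)^j(q-1)&-1&-1&0&-\nu_{q+1}^{jm}\\ \xi_1 & \frac{q+1}{2}&\frac{\epsilon(q+1)}{2}&\frac{1+\sqrt{\epsilon q}}{2}&\frac{1-\sqrt{\epsilon q}}{2}&(-1)^l&0\\ \xi_2 & \frac{q+1}{2}&\frac{\epsilon(q+1)}{2}&\frac{1-\sqrt{\epsilon q}}{2}&\frac{1+\sqrt{\epsilon q}}{2}&(-1)^l&0\\ \eta_1 & \frac{q-1}{2}&-\frac{\epsilon(q-1)}{2}&\frac{-1+\sqrt{\epsilon q}}{2}&\frac{-1-\sqrt{\epsilon q}}{2}&0&(-1)^{m+1}\\ \eta_2 & \frac{q-1}{2}&-\frac{\epsilon(q-1)}{2}&\frac{-1-\sqrt{\epsilon q}}{2}&\frac{-1+\sqrt{\epsilon q}}{2}&0&(-1)^{m+1}\end{array}$$ and $\chi(zc)=\frac{\chi(z)}{\chi(\mathbf 1)}\chi(c)$, $\chi(zd)=\frac{\chi(z)}{\chi(\mathbf 1)}\chi(d)$ for each of these characters $\chi$. The characters of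 the real irreducible representations of $\mathrm{SL}_2(q)$ are $\mathbf{1},\psi,\chi_{2i},2\chi_{2i'+1},\theta_{2j},2\theta_{2j'+1}$ (with $1\le 2i,2i'+1\le (q-3)/2$, $1\le 2j,2j'+1\le (q-1)/2$), together with $\xi_1,\xi_2,2\eta_1,2\eta_2$ if $q\equiv 1\pmod 4$, and $2\operatorname{Re}\xi_1=\xi_1+\xi_2$, $2\operatorname{Re}\eta_1=\eta_1+\eta_2$ if $q\equiv 3\pmod 4$. For such a character $\chi$ and a subgroup $H\le \mathrm{SL}_2(q)$, $\dim\chi^H$ denotes $\dim_{\mathbb{R}}V^H$, where $V$ is the real irreducible representation with character $\chi$ and $V^H$ its subspace of $H$-fixed vectors. *)

(* Defs.v *)
From HB Require Import structures.
From mathcomp Require Import all_boot all_order all_algebra all_fingroup.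
From mathcomp Require Import cyclic mxrepresentation.
From mathcomp Require Import complex.
From mathcomp Require Import reals trigo.

Set Implicit Arguments.
Unset Strict Implicit.
Unset Printing Implicit Defensive.

Import Order.TTheory GRing.Theory Num.Theory GroupScope.
Local Open Scope ring_scope.
Local Open Scope complex_scope.

Section SL2.
Variable q : nat.

Definition SL2 : {set {'GL_2(q)}} := [set u | \det (GLval u) == 1].

Lemma SL2_group_set : group_set SL2.
Proof.
apply/group_setP; split; first by rewrite inE GL_1E det1.
by move=> u v; rewrite !inE GL_ME det_mulmx => /eqP-> /eqP->; rewrite mulr1.
Qed.
Canonical SL2_group := Group SL2_group_set.

Definition mx2 (x y u v : 'F_q) : 'M['F_q]_2 :=
  \matrix_(i < 2, j < 2) if i == 0 then (if j == 0 then x else y)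
                         else (if j == 0 then u else v).

Lemma det_mx2 x y u v : \det (mx2 x y u v) = x * v - y * u.
Proof.
rewrite (expand_det_row _ ord0) !big_ord_recl big_ord0 /cofactor !det_mx11.
by rewrite !mxE /= addr0 expr0 expr1 mul1r mulN1r mulrN.
Qed.

(* The default value 1 of insubd is never used when the determinant is 1, *)
(* see SL2_mxK; this is the case for all the elements defined below.      *)
Definition SL2_mx (M : 'M['F_q]_2) : {'GL_2(q)} := insubd (1%g : {'GL_2(q)}) M.

Lemma SL2_mxK M : \det M = 1 -> GLval (SL2_mx M) = M.
Proof.
by move=> dM; apply: (insubdK (1%g : {'GL_2(q)})); rewrite unfold_in /= -/(M \in unitmx) unitmxE dM unitr1.
Qed.

Variable nu : {unit 'F_q}.

Definition SL2_z : {'GL_2(q)} := SL2_mx (mx2 (-1) 0 0 (-1)).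
Definition SL2_c : {'GL_2(q)} := SL2_mx (mx2 1 0 1 1).
Definition SL2_d : {'GL_2(q)} := SL2_mx (mx2 1 0 (val nu) 1).
Definition SL2_a : {'GL_2(q)} := SL2_mx (mx2 (val nu) 0 0 (val nu)^-1).

Lemma val_SL2_z : GLval SL2_z = mx2 (-1) 0 0 (-1).
Proof. by rewrite SL2_mxK // det_mx2 mulrNN mulr1 mulr0 subr0. Qed.
Lemma val_SL2_c : GLval SL2_c = mx2 1 0 1 1.
Proof. by rewrite SL2_mxK // det_mx2 mulr1 mul0r subr0. Qed.
Lemma val_SL2_d : GLval SL2_d = mx2 1 0 (val nu) 1.
Proof. by rewrite SL2_mxK // det_mx2 mulr1 mul0r subr0. Qed.
Lemma val_SL2_a : GLval SL2_a = mx2 (val nu) 0 0 (val nu)^-1.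
Proof.
by rewrite SL2_mxK // det_mx2 mulr0 subr0 divrr //; exact: (valP nu).
Qed.

End SL2.

Section Characters.
Variables (R : realType) (gT : finGroupType) (G : {group gT}).

Definition is_complex_irr_char (chi : gT -> R[i]) : Prop :=
  exists n (rG : mx_representation R[i] G n),
    mx_irreducible rG /\ forall g, g \in G -> chi g = \tr (rG g).

Definition real_irr_affords n (rG : mx_representation R G n)
    (chi : gT -> R[i]) : Prop :=
  mx_irreducible rG /\ forall g, g \in G -> (\tr (rG g))%:C = chi g.

(* dim chi^H = k.  A real irreducible representation with a given character *)
(* is unique up to isomorphism, so quantifying over all of them amounts to  *)
(* choosing one.                                                            *)
Definition real_fix_dim (chi : gT -> R[i]) (H : {set gT}) (k : nat) : Prop :=
  forall n (rG : mx_representation R G n),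
    real_irr_affords rG chi -> \rank (rfix_mx rG H) = k.

Definition char_twice (chi : gT -> R[i]) : gT -> R[i] := fun g => chi g *+ 2.
Definition char_twice_Re (chi : gT -> R[i]) : gT -> R[i] :=
  fun g => 'Re (chi g) *+ 2.

End Characters.

Section Table.
Variables (R : realType) (q : nat).
Local Notation C := (R[i]).

Definition zeta (r : nat) : C :=
  cos (2 * pi / r%:R) +i* sin (2 * pi / r%:R).

Definition nu_sum (r s : nat) : C := zeta r ^+ s + zeta r ^- s.

Definition epsilon : C := (-1) ^+ ((q - 1)./2).

Definition sqrt_eps_q : C := sqrtC (epsilon * q%:R).

Record table_row := TableRow {
  at_one : C;
  at_z : C;
  at_c : C;
  at_d : C;
  at_a : nat -> C; (* l |-> value at a ^ l *)
  at_b : nat -> C  (* m |-> value at b ^ m *)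
}.

Definition psi_row := TableRow
  q%:R q%:R 0 0 (fun=> 1) (fun=> -1).

Definition chi_row (i : nat) := TableRow
  (q%:R + 1) ((-1) ^+ i * (q%:R + 1)) 1 1
  (fun l => nu_sum q.-1 (i * l)) (fun=> 0).

Definition theta_row (j : nat) := TableRow
  (q%:R - 1) ((-1) ^+ j * (q%:R - 1)) (-1) (-1)
  (fun=> 0) (fun m => - nu_sum q.+1 (j * m)).

Definition xi1_row := TableRow
  ((q%:R + 1) / 2) (epsilon * (q%:R + 1) / 2)
  ((1 + sqrt_eps_q) / 2) ((1 - sqrt_eps_q) / 2)
  (fun l => (-1) ^+ l) (fun=> 0).

Definition xi2_row := TableRow
  ((q%:R + 1) / 2) (epsilon * (q%:R + 1) / 2)
  ((1 - sqrt_eps_q) / 2) ((1 + sqrt_eps_q) / 2)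
  (fun l => (-1) ^+ l) (fun=> 0).

Definition eta1_row := TableRow
  ((q%:R - 1) / 2) (- (epsilon * (q%:R - 1) / 2))
  ((-1 + sqrt_eps_q) / 2) ((-1 - sqrt_eps_q) / 2)
  (fun=> 0) (fun m => (-1) ^+ m.+1).

Definition eta2_row := TableRow
  ((q%:R - 1) / 2) (- (epsilon * (q%:R - 1) / 2))
  ((-1 - sqrt_eps_q) / 2) ((-1 + sqrt_eps_q) / 2)
  (fun=> 0) (fun m => (-1) ^+ m.+1).

Definition is_SL2_irr (nu : {unit 'F_q}) (b : {'GL_2(q)})
    (chi : {'GL_2(q)} -> C) (row : table_row) : Prop :=
  let z := SL2_z q in let c := SL2_c q in let d := SL2_d nu in
  let a := SL2_a nu in
  is_complex_irr_char (SL2_group q) chi /\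
  [/\ chi 1%g = at_one row, chi z = at_z row,
      chi c = at_c row & chi d = at_d row] /\
  [/\ forall l, (1 <= l <= (q - 3)./2)%N -> chi (a ^+ l)%g = at_a row l,
      forall m, (1 <= m <= (q - 1)./2)%N -> chi (b ^+ m)%g = at_b row m,
      chi (z * c)%g = chi z / chi 1%g * chi c &
      chi (z * d)%g = chi z / chi 1%g * chi d].

End Table.

(* Main.v *)
From HB Require Import structures.
Require Import Defs.
From mathcomp Require Import all_boot all_order all_algebra all_fingroup.
From mathcomp Require Import cyclic mxrepresentation complex reals trigo.
From mathcomp Require Import ring.

Set Implicit Arguments.
Unset Strict Implicit.
Unset Printing Implicit Defensive.

Import Order.TTheory GRing.Theory Num.Theory GroupScope.
Local Open Scope ring_scope.

(** Let [V] be a real representation of [SL2 q] with character [f].  Averaging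
    over [H] projects [V] onto its [H]-fixed vectors, and the trace of a
    projection is its rank, so [#|H| * dim V^H = \sum_(h in H) f h]
    ([rank_rfix_mx]).

    Let [u x] be the lower unipotent matrix with corner entry [x].  Since [q]
    is odd, [z * c] and [z * d] both generate the group of order [2 * q] formed
    by all the elements [u x] and [z * u x] ([cycle_z_lunip]): the parity and
    the residue modulo [q] of an exponent can be prescribed independently.  In
    particular the two choices for [H] are the same subgroup.  Conjugating by
    a diagonal matrix multiplies the corner entry by a nonzero square, so on
    the nonzero [x] the function [x |-> f (u x)] depends only on the class of
    [x] modulo squares.  One half of the nonzero [x] are squares and give the
    value at [c], the others give the value at [d]
    ([sum_square_invariant]); the same holds on the coset of [z].  Hence
    [2 * \sum_(h in H) f h] is
    [2 * (f 1 + f z) + (q - 1) * (f c + f d + f (z * c) + f (z * d))]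
    ([sum_class_fun]).

    In each row of the table the values at [z], [z * c] and [z * d] are those at
    [1], [c] and [d] multiplied by a sign [w].  This survives doubling, and
    doubling the real part, whence the dimension [k] is given by
    [(1 + w) * (2 * f 1 + (q - 1) * (f c + f d)) = 4 * q * k]
    ([fix_dim_z_scalar]).  For [w = -1] this is [0]: no nonzero vector is fixed,
    because [H] contains [z], which acts as [-1].  For [w = 1] it remains to
    read the values at [1], [c] and [d] off the table, where the
    square roots of [epsilon * q] cancel in [f c + f d]. *)

(** * Fixed subspaces and characters *)

(** A full-rank factorization [P = A *m B] of an idempotent satisfies
    [B *m A = 1], so that [\tr P = \tr (B *m A)] is the rank. *)
Lemma mxtrace_idempotent (F : fieldType) n (P : 'M[F]_n) :
  P *m P = P -> \tr P = (\rank P)%:R.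
Proof.
move=> PP; move: (mulmx_base P) (col_base_full P) (row_base_free P).
move: (col_base P) (row_base P) => A B AB fullA freeB.
have BA1 : B *m A = 1%:M.
  apply: (row_full_inj fullA); apply: (row_free_inj freeB).
  by rewrite /= mulmx1 !mulmxA AB -mulmxA AB.
by rewrite -{1}AB mxtrace_mulC BA1 mxtrace1.
Qed.

(** The average [P] of the matrices [rG h] over [H] is an idempotent with
    row space the [H]-fixed vectors. *)
Lemma rank_rfix_mx (F : fieldType) (gT : finGroupType) (G H : {group gT}) n
    (rG : mx_representation F G n) :
  H \subset G -> #|H|%:R != 0 :> F ->
  #|H|%:R * (\rank (rfix_mx rG H))%:R = \sum_(h in H) \tr (rG h).
Proof.
move=> sHG nzH.
pose P := #|H|%:R^-1 *: \sum_(h in H) rG h.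
have fixP m (W : 'M_(m, n)) : (W <= rfix_mx rG H)%MS -> W *m P = W.
  move/rfix_mxP=> fixW; rewrite -scalemxAr mulmx_sumr (eq_bigr (fun=> W)) //.
  by rewrite sumr_const -scaler_nat scalerA mulVf ?scale1r.
have subP : (P <= rfix_mx rG H)%MS.
  apply/rfix_mxP=> x Hx; rewrite -scalemxAl mulmx_suml; congr (_ *: _).
  rewrite [RHS](reindex_inj (mulIg x)) /=.
  by apply: eq_big => [h|h Hh]; rewrite ?groupMr // repr_mxM ?(subsetP sHG).
have rkP : \rank P = \rank (rfix_mx rG H).
  apply/eqP; rewrite eqn_leq mxrankS //=.
  by rewrite -{1}(fixP _ _ (submx_refl _)) mxrankM_maxr.
rewrite -rkP -mxtrace_idempotent ?fixP //.
by rewrite mxtraceZ mulrA mulfV // mul1r raddf_sum.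
Qed.

(** * The subgroup generated by a lower unipotent element and -1 *)

(** The matrices below are locked because conversion would otherwise unfold
    them down to arithmetic in the finite field. *)
HB.lock Definition lunip (q : nat) (x : 'F_q) : {'GL_2(q)} :=
  SL2_mx (mx2 1 0 x 1).
HB.lock Definition sldiag (q : nat) (s : 'F_q) : {'GL_2(q)} :=
  SL2_mx (mx2 s 0 0 s^-1).

Section LowerUnipotent.
Variables (q : nat) (q_prime : prime q) (q_odd : odd q).
Local Notation z := (SL2_z q).
Local Notation lunip := (@lunip q).
Local Notation sldiag := (@sldiag q).

Lemma mx2_mul (x y u v x' y' u' v' : 'F_q) :
  mx2 x y u v *m mx2 x' y' u' v' =
  mx2 (x * x' + y * u') (x * y' + y * v') (u * x' + v * u') (u * y' + v * v').
Proof.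
apply/matrixP=> i j; rewrite !mxE !big_ord_recl big_ord0 !mxE /= addr0.
by case: (i == 0); case: (j == 0).
Qed.

Lemma val_lunip x : GLval (lunip x) = mx2 1 0 x 1.
Proof. by rewrite unlock SL2_mxK // det_mx2 mulr1 mul0r subr0. Qed.

Lemma val_sldiag s : s != 0 -> GLval (sldiag s) = mx2 s 0 0 s^-1.
Proof. by move=> nzs; rewrite unlock SL2_mxK // det_mx2 mulr0 subr0 mulfV. Qed.

Lemma GLval_inj (u v : {'GL_2(q)}) : GLval u = GLval v -> u = v.
Proof. exact: val_inj. Qed.

Lemma GLvalM (u v : {'GL_2(q)}) : GLval (u * v) = GLval u *m GLval v.
Proof. by []. Qed.

Lemma lunip0 : lunip 0 = 1%g.
Proof.
apply: GLval_inj; rewrite val_lunip; apply/matrixP=> i j; rewrite !mxE.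
by case: i j => [[|[|]] //= ?] [[|[|]] //= ?].
Qed.

Lemma lunip_inj : injective lunip.
Proof.
move=> x y xy; have := val_lunip x; rewrite xy val_lunip.
by move=> /matrixP/(_ ord_max ord0); rewrite !mxE.
Qed.

Lemma lunipD x y : lunip (x + y) = (lunip x * lunip y)%g.
Proof.
apply: GLval_inj; rewrite GLvalM !val_lunip mx2_mul.
by congr mx2; ring.
Qed.

Lemma lunipMn x n : lunip (x *+ n) = (lunip x ^+ n)%g.
Proof. by elim: n => [|n IHn]; rewrite ?lunip0 // mulrS expgS lunipD IHn. Qed.

Lemma lunip_conj x s : s != 0 -> (lunip x ^ sldiag s)%g = lunip (s ^+ 2 * x).
Proof.
move=> nzs; apply: (mulgI (sldiag s)); rewrite conjgE !mulgA mulgV mul1g.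
apply: GLval_inj; rewrite !GLvalM !val_lunip !val_sldiag // !mx2_mul.
by congr mx2; field.
Qed.

Lemma comm_z u : commute z u.
Proof.
apply: GLval_inj; rewrite !GLvalM val_SL2_z.
have -> : mx2 (-1) 0 0 (-1) = (-1)%:M :> 'M['F_q]_2.
  by apply/matrixP=> -[[|[|]] //= ?] [[|[|]] //= ?]; rewrite !mxE.
by rewrite scalar_mxC.
Qed.

Lemma z_sqr : (z ^+ 2 = 1)%g.
Proof.
rewrite -lunip0; apply: GLval_inj; rewrite expgS expg1 GLvalM.
by rewrite val_SL2_z val_lunip mx2_mul; congr mx2; ring.
Qed.

Lemma z_exp n : (z ^+ n = z ^+ odd n)%g.
Proof.
rewrite -{1}[n]odd_double_half expgD -mul2n expgM z_sqr expg1n.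
by rewrite mulg1.
Qed.

Lemma z_lunip_inj :
  injective (fun ex : bool * 'F_q => (z ^+ ex.1 * lunip ex.2)%g).
Proof.
have z_neq x y : (z * lunip x)%g <> lunip y.
  move=> zxy; have: GLval z *m GLval (lunip x) = GLval (lunip y).
    by rewrite -GLvalM zxy.
  rewrite val_SL2_z !val_lunip mx2_mul.
  move=> /matrixP/(_ ord0 ord0); rewrite !mxE /= mul0r mulr1 addr0.
  move/eqP; rewrite eq_sym -subr_eq0 opprK -(natrD _ 1 1).
  rewrite -(dvdn_pcharf (pchar_Fp q_prime)) dvdn_prime2 //.
  by move=> /eqP q2; move: q_odd; rewrite q2.
move=> [[] x] [[] y] /=; rewrite ?expg0 ?expg1 ?mul1g.
- by move/mulgI/lunip_inj->.
- by move/z_neq.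
- by move/esym/z_neq.
- by move/lunip_inj->.
Qed.

(** The [n]-th power of [z * lunip t] is [z ^+ odd n * lunip (t *+ n)].  As [q]
    is odd, adding [q] to [n] changes its parity and fixes [t *+ n], so every
    pair of a sign and an element of the field is reached. *)
Lemma cycle_z_lunip (t : 'F_q) : t != 0 ->
  <[(z * lunip t)%g]>%g = [set (z ^+ ex.1 * lunip ex.2)%g | ex : bool * 'F_q].
Proof.
move=> nzt.
have zlunipX n : ((z * lunip t) ^+ n = z ^+ odd n * lunip (t *+ n))%g.
  by rewrite expgMn ?lunipMn -?z_exp //; apply: comm_z.
apply/setP=> u; apply/cycleP/imsetP=> [[n ->] | [[e x] _ ->] /=].
  by exists (odd n, t *+ n).
pose m := val (x / t).
have tm : t *+ m = x.
  by rewrite -mulr_natr /m natr_Zp mulrC divfK.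
exists (m + (odd m != e) * q)%N; rewrite zlunipX; congr (z ^+ _ * lunip _)%g.
  by rewrite oddD oddM q_odd andbT oddb; case: (odd m); case: e.
by rewrite mulrnDr tm -mulr_natr natrM pchar_Fp_0 // !mulr0 addr0.
Qed.

End LowerUnipotent.

(** * Sums of class functions *)

(** Every nonzero [x] is a power of [nu], and a factor [nu ^+ 2] does not change
    [g]; so [g x] and [g (nu * x)] are [g 1] and [g nu] in some order.  Summing
    over [x] counts each term of the left-hand sum twice, as [nu * x] also runs
    over the nonzero elements. *)
Lemma sum_square_invariant (K : finFieldType) (V : nmodType) (g : K -> V)
    (nu : {unit K}) :
  generator [set: {unit K}] nu ->
  (forall s x, s != 0 -> g (s ^+ 2 * x) = g x) ->
  (\sum_(x | x != 0) g x) *+ 2 = (g 1 + g (val nu)) *+ #|K|.-1.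
Proof.
move=> /eqP nu_gen g_sq; have nz_nu : val nu != 0 by rewrite -unitfE (valP nu).
have pairE x : x != 0 -> g x + g (val nu * x) = g 1 + g (val nu).
  rewrite -unitfE => Ux.
  have /cycleP[n /(congr1 val)] : FinRing.unit K Ux \in <[nu]>%g.
    by rewrite -nu_gen inE.
  rewrite FinRing.val_unitX /= => ->; elim: n => [|n IHn].
    by rewrite expr0 mulr1.
  by rewrite exprS mulrA -expr2 g_sq // addrC.
have sum_nu : \sum_(x | x != 0) g (val nu * x) = \sum_(x | x != 0) g x.
  rewrite [RHS](reindex_inj (mulfI nz_nu)).
  by apply: eq_bigl => x; rewrite mulf_eq0 negb_or nz_nu.
rewrite mulr2n -{2}sum_nu -big_split /= (eq_bigr _ pairE) sumr_const.
by rewrite -(cardC1 (0 : K)).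
Qed.

Definition class_fun (gT : finGroupType) (V : Type) (G : {group gT})
    (f : gT -> V) :=
  {in G &, forall u v, f (u ^ v)%g = f u}.

Lemma class_fun_mxtrace (F : fieldType) (gT : finGroupType) (G : {group gT}) n
    (rG : mx_representation F G n) : class_fun G (fun u => \tr (rG u)).
Proof.
move=> u v Gu Gv /=; rewrite conjgE !repr_mxM ?groupM ?groupV // mxtrace_mulC.
by rewrite -mulmxA -repr_mxM ?groupV // mulgV repr_mx1 mulmx1.
Qed.

Section SL2ClassFunctions.
Variables (q : nat) (q_prime : prime q) (q_odd : odd q).
Variables (nu : {unit 'F_q}) (nu_gen : generator [set: {unit 'F_q}] nu).
Local Notation z := (SL2_z q).
Local Notation c := (SL2_c q).
Local Notation d := (SL2_d nu).
Local Notation lunip := (@lunip q).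
Local Notation sldiag := (@sldiag q).

Lemma lunip1E : lunip 1 = c.
Proof. by apply: GLval_inj; rewrite val_lunip val_SL2_c. Qed.

Lemma lunip_nuE : lunip (val nu) = d.
Proof. by apply: GLval_inj; rewrite val_lunip val_SL2_d. Qed.

Lemma z_lunip_SL2 (e : bool) x : (z ^+ e * lunip x)%g \in SL2 q.
Proof.
have z_SL2 : z \in SL2_group q.
  by rewrite inE val_SL2_z det_mx2 mulrNN mulr1 mulr0 subr0.
apply: (@groupM _ (SL2_group q)); first exact: groupX.
by rewrite inE val_lunip det_mx2 mulr1 mul0r subr0.
Qed.

Lemma sum_class_fun (V : nmodType) (f : {'GL_2(q)} -> V)
    (H : {group {'GL_2(q)}}) :
  class_fun (SL2_group q) f ->
  H :=: <[(z * c)%g]>%g \/ H :=: <[(z * d)%g]>%g ->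
  [/\ H \subset SL2 q, #|H| = (2 * q)%N &
   (\sum_(h in H) f h) *+ 2 =
   (f 1%g + f z) *+ 2 + (f c + f d + (f (z * c)%g + f (z * d)%g)) *+ q.-1].
Proof.
move=> f_cl H_def.
have HE : H :=: [set (z ^+ ex.1 * lunip ex.2)%g | ex : bool * 'F_q].
  case: H_def => ->; rewrite -?lunip1E -?lunip_nuE cycle_z_lunip ?oner_eq0 //.
  by rewrite -unitfE (valP nu).
split.
- by rewrite HE; apply/subsetP=> u /imsetP[ex _ ->]; apply: z_lunip_SL2.
- rewrite HE card_imset; last exact: z_lunip_inj.
  by rewrite card_prod card_bool card_Fp.
(* The part of the sum in the coset of [z ^+ e]; [x = 0] gives [z ^+ e]. *)
have sumE (e : bool) : (\sum_x f (z ^+ e * lunip x)%g) *+ 2 =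
    f (z ^+ e)%g *+ 2 + (f (z ^+ e * c)%g + f (z ^+ e * d)%g) *+ q.-1.
  rewrite (bigD1 0) //= lunip0 // mulg1 mulrnDl.
  rewrite (sum_square_invariant nu_gen) ?card_Fp ?lunip1E ?lunip_nuE //.
  move=> s x nzs; rewrite -lunip_conj // -[RHS](f_cl _ (sldiag s)) ?z_lunip_SL2 //.
    by rewrite conjMg conjXg [(z ^ _)%g]conjgE (comm_z (sldiag s)) mulKg.
  by rewrite inE val_sldiag // det_mx2 mulr0 subr0 mulfV.
rewrite (eq_bigl [in [set (z ^+ ex.1 * lunip ex.2)%g | ex : bool * 'F_q]]);
  last by move=> u; rewrite HE.
rewrite big_imset /=; last by move=> ? ? _ _; apply: z_lunip_inj.
rewrite -(pair_bigA _ (fun (e : bool) x => f (z ^+ e * lunip x)%g)) /= big_bool /=.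
rewrite mulrnDl (sumE true) (sumE false) /= !expg0 !expg1 !mul1g.
rewrite [LHS]addrACA -(mulrnDl 2) -(mulrnDl q.-1) [f z + _]addrC.
by rewrite [f (z * c)%g + _ + _]addrC.
Qed.

End SL2ClassFunctions.

(** * Dimensions from character values *)

(** The passage from the rank formula over [R] to complex character values:
    [t1, tz, tc, td, tzc, tzd] are the traces at [1, z, c, d, z * c, z * d], [w]
    is the scalar by which [z] acts, and [r] is the rank. *)
Lemma fix_dim_arith (R : realType) (q k r : nat) (t1 tz tc td tzc tzd : R)
    (f1 fc fd w : R[i]) :
  (0 < q)%N ->
  ((2 * q)%:R * r%:R) *+ 2 = (t1 + tz) *+ 2 + (tc + td + (tzc + tzd)) *+ q.-1 ->
  t1%:C%C = f1 -> tz%:C%C = w * f1 -> tc%:C%C = fc -> td%:C%C = fd ->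
  tzc%:C%C = w * fc -> tzd%:C%C = w * fd ->
  (1 + w) * (f1 *+ 2 + (fc + fd) * (q%:R - 1)) = (4 * (q * k))%:R -> r = k.
Proof.
move=> q_gt0 + t1E tzE tcE tdE tzcE tzdE fk.
rewrite -[_ *+ q.-1]mulr_natr -subn1 natrB // natrM => rE.
have nz : (4 * q)%:R != 0 :> R[i] by rewrite pnatr_eq0 muln_eq0 -lt0n q_gt0.
apply/eqP; rewrite -(eqr_nat R[i]); apply/eqP/(mulfI nz).
transitivity ((4 * (q * k))%:R : R[i]); last by rewrite !natrM mulrA.
rewrite -fk; transitivity (real_complex R (2%:R * q%:R * r%:R *+ 2)).
  by rewrite natrM; ring.
by rewrite rE; ring: t1E tzE tcE tdE tzcE tzdE.
Qed.

Section FixedSpace.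
Variables (R : realType) (q : nat) (q_prime : prime q) (q_odd : odd q).
Variables (nu : {unit 'F_q}) (nu_gen : generator [set: {unit 'F_q}] nu).
Variable (H : {group {'GL_2(q)}}).
Hypothesis H_def :
  H :=: <[(SL2_z q * SL2_c q)%g]>%g \/ H :=: <[(SL2_z q * SL2_d nu)%g]>%g.
Local Notation z := (SL2_z q).
Local Notation c := (SL2_c q).
Local Notation d := (SL2_d nu).
Local Notation G := (SL2_group q).
Implicit Types (f : {'GL_2(q)} -> R[i]) (w : R[i]).

(** For the character of a representation this holds when [z] acts as the scalar
    [w]; only the values that occur in sums over [H] are mentioned, so that
    doubles and real parts of characters are covered too. *)
Definition z_scalar f w :=
  [/\ f z = w * f 1%g, f (z * c)%g = w * f c & f (z * d)%g = w * f d].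

(** The left-hand side of the hypothesis on [k] is twice the sum of [f] over
    [H], which is [2 * #|H|] times the dimension; [4 * q] is [2 * #|H|]. *)
Lemma fix_dim_z_scalar f w (f1 fc fd : R[i]) k : z_scalar f w ->
  f 1%g = f1 -> f c = fc -> f d = fd ->
  (1 + w) * (f1 *+ 2 + (fc + fd) * (q%:R - 1)) = (4 * (q * k))%:R ->
  real_fix_dim G f H k.
Proof.
move=> [fz fzc fzd] f1E fcE fdE fk n rG [_ rGf].
have [sHG cardH sumH] :=
  sum_class_fun q_prime q_odd nu_gen (class_fun_mxtrace rG) H_def.
have q_gt0 := prime_gt0 q_prime.
have Gzlunip e x := z_lunip_SL2 e (x : 'F_q).
have Gz : z \in G by have := Gzlunip true 0; rewrite lunip0 mulg1.
have Gc : c \in G by have := Gzlunip false 1; rewrite lunip1E mul1g.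
have Gd : d \in G by have := Gzlunip false (val nu); rewrite lunip_nuE mul1g.
have Gzc : (z * c)%g \in G by have := Gzlunip true 1; rewrite lunip1E.
have Gzd : (z * d)%g \in G by have := Gzlunip true (val nu); rewrite lunip_nuE.
have := rank_rfix_mx rG sHG; rewrite cardH pnatr_eq0 -lt0n muln_gt0 q_gt0.
move=> /(_ isT) rankE; rewrite -rankE in sumH.
have rG1 := etrans (rGf _ (group1 _)) f1E.
have rGc := etrans (rGf _ Gc) fcE.
have rGd := etrans (rGf _ Gd) fdE.
have rGz := etrans (rGf _ Gz) (etrans fz (congr1 ( *%R w) f1E)).
have rGzc := etrans (rGf _ Gzc) (etrans fzc (congr1 ( *%R w) fcE)).
have rGzd := etrans (rGf _ Gzd) (etrans fzd (congr1 ( *%R w) fdE)).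
exact: (fix_dim_arith q_gt0 sumH rG1 rGz rGc rGd rGzc rGzd fk).
Qed.
End FixedSpace.

Section TableRows.
Variables (R : realType) (q : nat) (q_prime : prime q) (q_odd : odd q).
Variables (nu : {unit 'F_q}) (nu_gen : generator [set: {unit 'F_q}] nu).
Variables (b : {'GL_2(q)}) (H : {group {'GL_2(q)}}).
Hypothesis H_def :
  H :=: <[(SL2_z q * SL2_c q)%g]>%g \/ H :=: <[(SL2_z q * SL2_d nu)%g]>%g.
Implicit Types (row : table_row R) (w : R[i]).

(** [2 * \sum_(h in H) f h] for a character [f] with table row [row], when [w]
    is the ratio of the values at [z] and [1]. *)
Definition row_sum row w : R[i] :=
  (1 + w) * (at_one row *+ 2 + (at_c row + at_d row) * (q%:R - 1)).

Variables (chi : {'GL_2(q)} -> R[i]) (row : table_row R) (w : R[i]).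
Hypotheses (chiP : is_SL2_irr nu b chi row) (row1_neq0 : at_one row != 0).
Hypothesis row_z : at_z row = w * at_one row.

Lemma z_scalar_row : z_scalar nu chi w.
Proof.
case: chiP => _ [[chi1 chiz _ _] [_ _ chizc chizd]].
have chizE := etrans chiz (etrans row_z (congr1 ( *%R w) (esym chi1))).
have ratioE : chi (SL2_z q) / chi 1%g = w.
  exact: etrans (congr2 (fun x y => x / y) chiz chi1) (canLR (mulfK row1_neq0) row_z).
split; first exact: chizE.
- exact: etrans chizc (congr1 (fun x => x * _) ratioE).
- exact: etrans chizd (congr1 (fun x => x * _) ratioE).
Qed.

Lemma fix_dim_row k :
  row_sum row w = (4 * (q * k))%:R -> real_fix_dim (SL2_group q) chi H k.
Proof.
case: (chiP) => _ [[chi1 _ chic chid] _].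
exact: (fix_dim_z_scalar q_prime q_odd nu_gen H_def z_scalar_row chi1 chic chid).
Qed.

Lemma fix_dim_twice_row :
  row_sum row w = 0 -> real_fix_dim (SL2_group q) (char_twice chi) H 0.
Proof.
case: (chiP) => _ [[chi1 _ chic chid] _] sum0; have [wz wzc wzd] := z_scalar_row.
have twice_mul x y : x = w * y -> x *+ 2 = w * (y *+ 2) by move->; rewrite mulrnAr.
have twiceE x y : x = y -> x *+ 2 = y *+ 2 :> R[i] by move->.
apply: (fix_dim_z_scalar (w := w) q_prime q_odd nu_gen H_def _
  (twiceE _ _ chi1) (twiceE _ _ chic) (twiceE _ _ chid)).
  exact: And3 (twice_mul _ _ wz) (twice_mul _ _ wzc) (twice_mul _ _ wzd).
by rewrite !muln0 mulr0n -[RHS](mulr0 2) -sum0 /row_sum; ring.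
Qed.

Lemma fix_dim_twice_Re_row : w \is Num.real ->
  row_sum row w = 0 -> real_fix_dim (SL2_group q) (char_twice_Re chi) H 0.
Proof.
move=> w_real; case: (chiP) => _ [[chi1 _ chic chid] _] sum0.
have [wz wzc wzd] := z_scalar_row.
have Re_mul x y : x = w * y -> 'Re x *+ 2 = w * ('Re y *+ 2).
  by move->; rewrite ReMl // mulrnAr.
have ReE x y : x = y -> 'Re x *+ 2 = 'Re y *+ 2 :> R[i] by move->.
apply: (fix_dim_z_scalar (w := w) q_prime q_odd nu_gen H_def _
  (ReE _ _ chi1) (ReE _ _ chic) (ReE _ _ chid)).
  exact: And3 (Re_mul _ _ wz) (Re_mul _ _ wzc) (Re_mul _ _ wzd).
have q1_real : q%:R - 1 \is @Num.real R[i] by rewrite rpredB ?rpred1 ?rpred_nat.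
have w1_real : 1 + w \is Num.real by rewrite rpredD ?rpred1.
move/(congr1 (fun x => 'Re x *+ 2)): sum0.
rewrite /row_sum !muln0 mulr0n raddf0 mul0rn => <-.
by rewrite ReMl // raddfD raddfMn /= ReMr // raddfD /=; ring.
Qed.

End TableRows.

Lemma epsilon1 (R : realType) q : q = 1 %[mod 4] -> epsilon R q = 1.
Proof.
move=> q1; rewrite /epsilon (divn_eq q 4) q1 addnK.
by rewrite -[4%N]/(2 * 2)%N mulnA muln2 doubleK muln2 -signr_odd odd_double.
Qed.

Lemma epsilonN1 (R : realType) q : q = 3 %[mod 4] -> epsilon R q = -1.
Proof.
move=> q3; rewrite /epsilon (divn_eq q 4) q3.
have -> : (q %/ 4 * 4 + 3 %% 4 - 1 = (q %/ 4 * 2 + 1).*2)%N.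
  by rewrite -muln2 mulnDl -mulnA -addnBA.
by rewrite doubleK addn1 exprS exprM sqrr_sign mulr1.
Qed.

(** * Evaluation on the character table *)

Theorem lemma5 (R : realType) (q : nat) (q_prime : prime q) (q_odd : odd q)
  (nu : {unit 'F_q}) (nu_gen : generator [set: {unit 'F_q}] nu)
  (b : {'GL_2(q)}) (b_SL2 : b \in SL2 q) (b_order : #[b]%g = q.+1)
  (psi : {'GL_2(q)} -> R[i]) (chi theta : nat -> {'GL_2(q)} -> R[i])
  (xi1 xi2 eta1 eta2 : {'GL_2(q)} -> R[i])
  (psiP : is_SL2_irr nu b psi (psi_row R q))
  (chiP : forall i : nat, (1 <= i <= (q - 3)./2)%N ->
     is_SL2_irr nu b (chi i) (chi_row R q i))
  (thetaP : forall j : nat, (1 <= j <= (q - 1)./2)%N ->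
     is_SL2_irr nu b (theta j) (theta_row R q j))
  (xi1P : is_SL2_irr nu b xi1 (xi1_row R q))
  (xi2P : is_SL2_irr nu b xi2 (xi2_row R q))
  (eta1P : is_SL2_irr nu b eta1 (eta1_row R q))
  (eta2P : is_SL2_irr nu b eta2 (eta2_row R q))
  (H : {group {'GL_2(q)}})
  (H_def : H :=: <[(SL2_z q * SL2_c q)%g]>%g \/
           H :=: <[(SL2_z q * SL2_d nu)%g]>%g) :
  [/\ real_fix_dim (SL2_group q) psi H 1,
      forall i : nat, (1 <= 2 * i <= (q - 3)./2)%N ->
        real_fix_dim (SL2_group q) (chi (2 * i)%N) H 2,
      forall i' : nat, (1 <= 2 * i' + 1 <= (q - 3)./2)%N ->
        real_fix_dim (SL2_group q) (char_twice (chi (2 * i' + 1)%N)) H 0,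
      forall j : nat, (1 <= 2 * j <= (q - 1)./2)%N ->
        real_fix_dim (SL2_group q) (theta (2 * j)%N) H 0 &
      forall j' : nat, (1 <= 2 * j' + 1 <= (q - 1)./2)%N ->
        real_fix_dim (SL2_group q) (char_twice (theta (2 * j' + 1)%N)) H 0] /\
  (q = 1 %[mod 4] ->
     [/\ real_fix_dim (SL2_group q) xi1 H 1,
         real_fix_dim (SL2_group q) xi2 H 1,
         real_fix_dim (SL2_group q) (char_twice eta1) H 0 &
         real_fix_dim (SL2_group q) (char_twice eta2) H 0]) /\
  (q = 3 %[mod 4] ->
     real_fix_dim (SL2_group q) (char_twice_Re xi1) H 0 /\
     real_fix_dim (SL2_group q) (char_twice_Re eta1) H 0).
Proof.
have q_gt1 := prime_gt1 q_prime.
have nzq : q%:R != 0 :> R[i] by rewrite pnatr_eq0 -lt0n ltnW.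
have nzqD : q%:R + 1 != 0 :> R[i] by rewrite -(natrD _ q 1) pnatr_eq0 addn1.
have nzqB : q%:R - 1 != 0 :> R[i].
  by rewrite subr_eq0 (eqr_nat _ q 1) gtn_eqF.
have half_neq0 (x : R[i]) : x != 0 -> x / 2 != 0.
  by move=> nzx; rewrite mulf_neq0 ?invr_eq0 ?pnatr_eq0.
have sign_even n : (-1) ^+ (2 * n) = 1 :> R[i] by rewrite exprM sqrrN !expr1n.
have sign_odd n : (-1) ^+ (2 * n + 1) = -1 :> R[i].
  by rewrite exprD sign_even mul1r.
have fixP := fix_dim_row q_prime q_odd nu_gen H_def.
have fix2P := fix_dim_twice_row q_prime q_odd nu_gen H_def.
have fixReP := fix_dim_twice_Re_row q_prime q_odd nu_gen H_def.
split; [split | split] => [|i Hi|i Hi|j Hj|j Hj|q1|q3].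
- apply: (fixP R b _ _ 1 psiP) => //=; first by rewrite mul1r.
  by rewrite /row_sum /= natrM natrM; ring.
- apply: (fixP R b _ _ 1 (chiP _ Hi)) => //=; first by rewrite sign_even.
  by rewrite /row_sum /= natrM natrM; ring.
- apply: (fix2P R b _ _ (-1) (chiP _ Hi)) => //=; first by rewrite sign_odd.
  by rewrite /row_sum /= addrN mul0r.
- apply: (fixP R b _ _ 1 (thetaP _ Hj)) => //=; first by rewrite sign_even.
  by rewrite /row_sum /= natrM natrM; ring.
- apply: (fix2P R b _ _ (-1) (thetaP _ Hj)) => //=; first by rewrite sign_odd.
  by rewrite /row_sum /= addrN mul0r.
(* Here [epsilon = 1]: [z] acts as [1] on the [xi] and as [-1] on the [eta]. *)
- split.
  + apply: (fixP R b _ _ 1 xi1P); rewrite /= ?half_neq0 ?epsilon1 ?mul1r //.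
    by rewrite /row_sum /= natrM natrM; field.
  + apply: (fixP R b _ _ 1 xi2P); rewrite /= ?half_neq0 ?epsilon1 ?mul1r //.
    by rewrite /row_sum /= natrM natrM; field.
  + apply: (fix2P R b _ _ (-1) eta1P); rewrite /= ?half_neq0 ?epsilon1;
      rewrite ?mul1r ?mulN1r //.
    by rewrite /row_sum /= addrN mul0r.
  + apply: (fix2P R b _ _ (-1) eta2P); rewrite /= ?half_neq0 ?epsilon1;
      rewrite ?mul1r ?mulN1r //.
    by rewrite /row_sum /= addrN mul0r.
(* Here [epsilon = -1], and the two signs are exchanged. *)
- split.
  + apply: (fixReP R b _ _ (-1) xi1P); rewrite /= ?half_neq0 ?rpredN ?rpred1 //.
      by rewrite epsilonN1 // mulrA.
    by rewrite /row_sum /= addrN mul0r.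
  + apply: (fixReP R b _ _ 1 eta1P); rewrite /= ?half_neq0 ?rpred1 //.
      by rewrite epsilonN1 // mulN1r mulNr opprK mul1r.
    by rewrite /row_sum /=; field.
Qed.
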